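(* Let $\kappa$ be bounded such that $|\kappa|\le \kappa^*$. If the step ratios satisfy $0<r_k<R_e$ for $k\ge2$ and the maximum time-step satisfies $\tau\le 1/(4K_3\kappa^* )$, then the BDF3 solution of the scheme $D_3u^{k}=\varepsilon\Delta u^{k}+\kappa u^{k}+f^k$ ($3\le k\le N$) satisfies \[ \|u^n\|\le 2\exp(4K_3\kappa^*t_{n-1})\Big( \|u^2\|+K_3\tau\|\partial_{\tau}u^1\|+4K_3\tau\|\partial_{\tau}u^2\|+2K_3t_n\max_{3\le k\le n}\|f^k\|\Big) \] for $3\le n\le N$. Thus the BDF3 scheme is mesh-robustly stable in the $L^2$ norm.
   Context: Consider the linear reaction-diffusion problem $\partial_tu-\varepsilon\Delta u=\kappa(x)u+f(t,x)$ for $x\in\Omega$, $0<t<T$, on a bounded convex domain $\Omega$ with smooth boundary, homogeneous Dirichlet boundary condition $u=0$ on $\partial\Omega$ and initial data $u(0,x)=u_0$; $\varepsilon>0$ is a constant and $\kappa(x)$ is smooth. $\|\cdot\|$ denotes the $L^2(\Omega)$ norm. Take a temporal mesh $0=t_0<t_1<\cdots<t_N=T$ with steps $\tau_k=t_k-t_{k-1}$, maximum step $\tau=\max_k\tau_k$, step ratios $r_k=\tau_k/\tau_{k-1}$ ($k\ge2$), and $\partial_\tau v^n=(v^n-v^{n-1})/\tau_n$. The variable-step BDF3 formula is $D_3v^n=d_0(r_n,r_{n-1})\partial_\tau v^n+d_1(r_n,r_{n-1})\partial_\tau v^{n-1}+d_2(r_n,r_{n-1})\partial_\tau v^{n-2}$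 with $d_0(x,y)=\frac{1+2x}{1+x}+\frac{xy}{1+y+xy}$, $d_1(x,y)=-\frac{x}{1+x}-\frac{xy}{1+y+xy}-\frac{xy^2}{1+y+xy}\frac{1+x}{1+y}$, $d_2(x,y)=\frac{xy^2}{1+y+xy}\frac{1+x}{1+y}$. Writing $D_3v^n=\sum_{j=1}^n d^{(n)}_{n-j}\partial_\tau v^j$ with $d^{(n)}_j=d_j(r_n,r_{n-1})$ for $j=0,1,2$ and $d^{(n)}_j=0$ for $j\ge3$, the discrete orthogonal convolution (DOC) kernels are defined by $\vartheta^{(n)}_0=1/d^{(n)}_0$ and $\vartheta^{(n)}_{n-j}=-\frac{1}{d^{(j)}_0}\sum_{i=j+1}^n\vartheta^{(n)}_{n-i}d^{(i)}_{i-j}$ for $3\le j\le n-1$. The starting values $u^1,u^2$ are given, $f^k=f(t_k,\cdot)$. $R_e\approx1.4877$ is the unique positive root of $\frac{10}{7(R_e+1)}-\frac{R_e^2\sqrt{R_e}}{R_e^2+R_e+1}=0$. $K_3$ is a positive constant (independent of $t_n$ and of the step ratios $r_k\in(0,R_e]$) such that, when $r_k\le R_e$, $\sum_{j=3}^n|\vartheta^{(n)}_{n-j}|\le K_3$ and $\sum_{j=i}^n|\vartheta^{(j)}_{j-i}|\le K_3$ for $n\ge3$, $i\ge3$. *)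

(* Defs.v *)
From HB Require Import structures.
From mathcomp Require Import all_boot all_order all_algebra.
From mathcomp Require Import reals sequences exp.
Set Implicit Arguments. Unset Strict Implicit. Unset Printing Implicit Defensive.
Import Order.TTheory GRing.Theory Num.Theory.
Local Open Scope ring_scope.

Section Defs.
Variable R : realType.

Definition is_Re (x : R) : Prop :=
  0 < x /\ 10 / (7 * (x + 1)) - x ^+ 2 * Num.sqrt x / (x ^+ 2 + x + 1) = 0.

Definition d0f (x y : R) : R := (1 + 2 * x) / (1 + x) + x * y / (1 + y + x * y).
Definition d1f (x y : R) : R :=
  - (x / (1 + x)) - x * y / (1 + y + x * y)
  - x * y ^+ 2 / (1 + y + x * y) * ((1 + x) / (1 + y)).
Definition d2f (x y : R) : R := x * y ^+ 2 / (1 + y + x * y) * ((1 + x) / (1 + y)).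

Definition dcoef (r : nat -> R) (n j : nat) : R :=
  match j with
  | 0 => d0f (r n) (r n.-1)
  | 1 => d1f (r n) (r n.-1)
  | 2 => d2f (r n) (r n.-1)
  | _ => 0
  end.

(* thetas r n m = [:: theta^{(n)}_0; ...; theta^{(n)}_m], where
   theta^{(n)}_0 = 1/d^{(n)}_0 and, with j = n - (m+1),
   theta^{(n)}_{n-j} = -(1/d^{(j)}_0) * sum_{i=j+1}^n theta^{(n)}_{n-i} d^{(i)}_{i-j}
   (index i here written as n - i' with i' = 0..m). *)
Fixpoint thetas (r : nat -> R) (n m : nat) : seq R :=
  match m with
  | 0 => [:: 1 / dcoef r n 0]
  | m'.+1 =>
      let s := thetas r n m' in
      rcons s (- (1 / dcoef r (n - m) 0) *
               \sum_(i < m) nth 0 s i * dcoef r (n - i) (m - i))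
  end.

Definition theta (r : nat -> R) (n m : nat) : R := nth 0 (thetas r n m) m.

Definition tau (t : nat -> R) (k : nat) : R := t k - t k.-1.
Definition stepratio (t : nat -> R) (k : nat) : R := tau t k / tau t k.-1.
Definition taumax (t : nat -> R) (N : nat) : R :=
  \big[Num.max/0]_(1 <= k < N.+1) tau t k.

(* abstract real inner-product space (models L^2(Omega)) *)
Definition inner_axioms (V : lmodType R) (ip : V -> V -> R) : Prop :=
  [/\ forall v w, ip v w = ip w v,
      forall a u v w, ip (a *: u + v) w = a * ip u w + ip v w,
      forall v, 0 <= ip v v
    & forall v, ip v v = 0 -> v = 0].

Definition ipnorm (V : lmodType R) (ip : V -> V -> R) (v : V) : R :=
  Num.sqrt (ip v v).

Definition dtau (V : lmodType R) (t : nat -> R) (u : nat -> V) (k : nat) : V :=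
  (tau t k)^-1 *: (u k - u k.-1).
Definition D3 (V : lmodType R) (t : nat -> R) (u : nat -> V) (n : nat) : V :=
  dcoef (stepratio t) n 0 *: dtau t u n + dcoef (stepratio t) n 1 *: dtau t u n.-1
  + dcoef (stepratio t) n 2 *: dtau t u n.-2.

End Defs.

(* Main.v *)
(* Convolving the scheme with the DOC kernels [theta] turns the BDF3 operator into
   the plain difference quotient of [u], up to terms carried by the two starting
   differences; testing with [2 tau_j u^j] and summing over [j] gives an energy
   inequality.

   The diffusion term has a sign because the convolution is positive semidefinite:
   with [u = D_3 v] it becomes [sum_k tau_k (D_3 v)_k v_k], and a fixed quadratic
   storage function of [(v_k, v_(k-1))] works for all step ratios below
   149/100 > R_e.

   The constants in front of the starting differences are too small for a direct
   use of the bound [K_3].  Two gains repair this: a column of [theta] scales like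
   [1 / d_0(r_i, r_(i-1))], so applying the bound [K_3] with a small [r_(i-1)]
   improves it; and keeping the first increment of the energy inequality halves the
   contribution of the diagonal kernel, which is a fixed fraction of the column sum
   since columns decay geometrically.

   At an index where the norm is maximal the energy inequality becomes linear, and
   the discrete Gronwall inequality concludes. *)
Require Import Defs.
From HB Require Import structures.
From mathcomp Require Import all_boot all_order all_algebra.
From mathcomp Require Import reals sequences exp.
From mathcomp Require Import zify ring lra.
Import Order.TTheory GRing.Theory Num.Theory.
Local Open Scope ring_scope.

(** * The BDF3 coefficients *)

(** For [x >= 149/100] the subtracted term is at least [471/1000 * 61/50 > 0.574], whereas the first
    term is at most [1000/1743 < 0.574], so no root lies there. *)
Lemma Re_lt (R : realType) (x : R) : is_Re x -> x < 149 / 100.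
Proof.
move=> [x0 eqx]; rewrite ltNge; apply/negP => x_ge.
have s_ge : 61 / 50 <= Num.sqrt x.
  have -> : 61 / 50 = Num.sqrt ((61 / 50) ^+ 2) :> R.
    by rewrite sqrtr_sqr ger0_norm //; lra.
  by rewrite ler_sqrt //; lra.
have q_ge : 471 / 1000 <= x ^+ 2 / (x ^+ 2 + x + 1).
  have xx : 149 / 100 * x <= x ^+ 2 by rewrite expr2 ler_wpM2r //; lra.
  by rewrite ler_pdivlMr; lra.
have p_le : 10 / (7 * (x + 1)) <= 1000 / 1743.
  by rewrite ler_pdivrMr; lra.
have : 471 / 1000 * (61 / 50) <= x ^+ 2 / (x ^+ 2 + x + 1) * Num.sqrt x.
  by apply: ler_pM => //; lra.
by move: eqx; rewrite (mulrAC (x ^+ 2)); lra.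
Qed.

Section Coefficients.
Context {R : realType}.
Implicit Types x y : R.

Lemma d2f_ge0 x y : 0 <= x -> 0 <= y -> 0 <= d2f x y.
Proof.
move=> x0 y0; rewrite /d2f; apply: mulr_ge0; apply: divr_ge0; nra.
Qed.

Lemma d1f_le0 x y : 0 <= x -> 0 <= y -> d1f x y <= 0.
Proof.
move=> x0 y0; rewrite /d1f.
have := d2f_ge0 _ _ x0 y0; rewrite /d2f.
have : 0 <= x / (1 + x) by apply: divr_ge0; lra.
have : 0 <= x * y / (1 + y + x * y) by apply: divr_ge0; nra.
lra.
Qed.

Lemma d0f_ge1 x y : 0 <= x -> 0 <= y -> 1 <= d0f x y.
Proof.
move=> x0 y0; rewrite /d0f.
have : 1 <= (1 + 2 * x) / (1 + x) by rewrite ler_pdivlMr; lra.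
have : 0 <= x * y / (1 + y + x * y) by apply: divr_ge0; nra.
lra.
Qed.

(** Source of the factor [8/5]: for nearly vanishing [y] only [(1 + 2x) / (1 + x)] matters, which
    stays below [1.599] on this range. *)
Lemma d0f_small x y :
  0 <= x <= 149 / 100 -> 0 <= y <= 1 / 1000 -> d0f x y <= 8 / 5.
Proof.
move=> x0 y0; rewrite /d0f.
have : (1 + 2 * x) / (1 + x) <= 1599 / 1000 - 5 / 10000.
  by rewrite ler_pdivrMr; lra.
have : x * y / (1 + y + x * y) <= 15 / 10000 by rewrite ler_pdivrMr; nra.
lra.
Qed.

(** If [p2 >= 0] all terms are nonnegative; otherwise the polynomial is concave and lies above its
    chord, whose end values are nonnegative. *)
Lemma quad_ge0 (rho p0 p1 p2 y : R) : 0 < rho -> 0 <= y <= rho ->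
  0 <= p0 -> 0 <= p1 -> 0 <= p0 + rho * p1 + rho ^+ 2 * p2 ->
  0 <= p0 + p1 * y + p2 * y ^+ 2.
Proof.
move=> rho0 /andP[y0 y_le] p00 p10 p_rho; rewrite -(pmulr_rge0 _ rho0).
have [p20|/ltW p20] := leP 0 p2.
  apply: mulr_ge0; first exact: ltW.
  by rewrite !addr_ge0 // mulr_ge0 // exprn_ge0.
have -> : rho * (p0 + p1 * y + p2 * y ^+ 2) = (rho - y) * p0
  + y * (p0 + rho * p1 + rho ^+ 2 * p2) + rho * (y * ((rho - y) * - p2)) by ring.
by rewrite !addr_ge0 ?mulr_ge0 ?subr_ge0 ?oppr_ge0 // ltW.
Qed.

Lemma d1f_le_d0f x y : 0 <= x <= 149 / 100 -> 0 <= y <= 149 / 100 ->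
  - d1f x y <= 6 / 7 * d0f x y.
Proof.
move=> x0 y0; rewrite -subr_ge0.
have -> : 6 / 7 * d0f x y - - d1f x y =
  ((6 + 5 * x) + (12 + 15 * x + 4 * x ^+ 2) * y
   + (6 + 3 * x - 10 * x ^+ 2 - 7 * x ^+ 3) * y ^+ 2)
  / (7 * (1 + x) * (1 + y + x * y) * (1 + y)).
  by rewrite /d0f /d1f; field; repeat (apply/andP; split); nra.
apply: divr_ge0; last by repeat apply: mulr_ge0; nra.
apply: (quad_ge0 (149 / 100)); nra.
Qed.

Lemma d2f_le_d0f x y : 0 <= x <= 149 / 100 -> 0 <= y <= 149 / 100 ->
  d2f x y <= 17 / 50 * d0f x y.
Proof.
move=> x0 y0; rewrite -subr_ge0.
have -> : 17 / 50 * d0f x y - d2f x y =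
  ((17 + 34 * x) + (34 + 102 * x + 51 * x ^+ 2) * y
   + (17 + 18 * x - 49 * x ^+ 2 - 50 * x ^+ 3) * y ^+ 2)
  / (50 * (1 + x) * (1 + y + x * y) * (1 + y)).
  by rewrite /d0f /d2f; field; repeat (apply/andP; split); nra.
apply: divr_ge0; last by repeat apply: mulr_ge0; nra.
apply: (quad_ge0 (149 / 100)); nra.
Qed.

(** Composing two steps of the recursion produces the product of two consecutive quotients
    [- d1 / d0]. Here one of them is replaced by its bound [6/7]. *)
Lemma d12f_le_d0f x y : 0 <= x <= 149 / 100 -> 0 <= y <= 149 / 100 ->
  - (6 / 7 * d1f x y) - d2f x y <= 2 / 5 * d0f x y.
Proof.
move=> x0 y0; rewrite -subr_ge0.
have -> : 2 / 5 * d0f x y - (- (6 / 7 * d1f x y) - d2f x y) =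
  ((14 - 2 * x) + (28 - 6 * x - 18 * x ^+ 2) * y
   + (14 + x - 8 * x ^+ 2 + 5 * x ^+ 3) * y ^+ 2)
  / (35 * (1 + x) * (1 + y + x * y) * (1 + y)).
  by rewrite /d0f /d1f /d2f; field; repeat (apply/andP; split); nra.
apply: divr_ge0; last by repeat apply: mulr_ge0; nra.
have [x1|x1] := leP x 1.
  have xx : x ^+ 2 <= 1 by nra.
  have xxx : 0 <= x ^+ 3 by apply: exprn_ge0; lra.
  apply: addr_ge0; first apply: addr_ge0; first lra.
    by apply: mulr_ge0; lra.
  by apply: mulr_ge0; rewrite ?sqr_ge0 //; lra.
(* For [x > 1] the linear coefficient in [y] may be negative, so the discriminant decides; it is
   estimated in [z = x - 1]. *)
have disc : (28 - 6 * x - 18 * x ^+ 2) ^+ 2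
    <= 4 * (14 - 2 * x) * (14 + x - 8 * x ^+ 2 + 5 * x ^+ 3).
  pose z := x - 1; have -> : x = z + 1 by rewrite /z; ring.
  have z0 : 0 <= z by rewrite /z; lra.
  have z1 : z <= 49 / 100 by rewrite /z; lra.
  have z2 : z ^+ 2 <= 1 / 4 by nra.
  have z3 : z ^+ 3 <= 1 / 8 by rewrite exprS; nra.
  have z4 : z ^+ 4 <= 1 / 16 by rewrite exprS; nra.
  lra.
have p20 : 0 < 14 + x - 8 * x ^+ 2 + 5 * x ^+ 3.
  pose z := x - 1; have -> : x = z + 1 by rewrite /z; ring.
  have z0 : 0 <= z by rewrite /z; lra.
  nra.
rewrite -(pmulr_rge0 _ p20).
move: p20 disc; set p2 := (14 + x - _ + _); set p1 := (28 - _ - _).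
set p0 := (14 - 2 * x).
move=> p20 disc.
have -> : p2 * (p0 + p1 * y + p2 * y ^+ 2) =
  (p2 * y + p1 / 2) ^+ 2 + (4 * p0 * p2 - p1 ^+ 2) / 4 by field.
by have := sqr_ge0 (p2 * y + p1 / 2); lra.
Qed.

(* [p0 + p1 y + (p2 + p3 y + p4 y^2) y^2] is the numerator of the expression in
   [storage_discr]; [p4] changes sign, hence the evaluation at [y = 3/2]. *)
Lemma storage_coef_ge0 x : 0 < x <= 149 / 100 ->
  let p0 := 24 + 160 * x + 128 * x ^+ 2 - 108 * x ^+ 3 in
  let p1 := 96 + 848 * x + 1192 * x ^+ 2 - 136 * x ^+ 3 - 376 * x ^+ 4 in
  let p2 := 144 + 1584 * x + 2932 * x ^+ 2 + 580 * x ^+ 3 - 1140 * x ^+ 4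
    - 328 * x ^+ 5 in
  let p3 := 96 + 1264 * x + 2800 * x ^+ 2 + 1176 * x ^+ 3 - 932 * x ^+ 4
    - 336 * x ^+ 5 + 140 * x ^+ 6 in
  let p4 := 24 + 368 * x + 932 * x ^+ 2 + 343 * x ^+ 3 - 968 * x ^+ 4
    - 958 * x ^+ 5 - 160 * x ^+ 6 + 175 * x ^+ 7 + 100 * x ^+ 8 in
  [/\ 0 <= p0, 0 <= p1, 0 <= p2, 0 <= p3
    & 0 <= p2 + 3 / 2 * p3 + (3 / 2) ^+ 2 * p4].
Proof.
move=> /andP[x0 x1] /=.
have pow_ge0 k : 0 <= x ^+ k by apply/exprn_ge0/ltW.
have pow_le k c : x <= c -> x ^+ k.+1 <= c * x ^+ k.
  by move=> xc; rewrite exprS ler_wpM2r.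
have pow_ge k c : c <= x -> c * x ^+ k <= x ^+ k.+1.
  by move=> xc; rewrite exprS ler_wpM2r.
have l1 : x ^+ 2 <= 149 / 100 * x by apply: (pow_le 1%N).
have := pow_le 5%N _ x1; have := pow_le 4%N _ x1.
have := pow_le 3%N _ x1; have := pow_le 2%N _ x1.
have := pow_ge0 8%N; have := pow_ge0 7%N; have := pow_ge0 6%N.
have := pow_ge0 5%N; have := pow_ge0 4%N; have := pow_ge0 3%N.
have := pow_ge0 2%N.
have hi : x <= 27 / 20 -> [/\ x ^+ 2 <= 27 / 20 * x,
    x ^+ 3 <= 27 / 20 * x ^+ 2, x ^+ 4 <= 27 / 20 * x ^+ 3,
    x ^+ 5 <= 27 / 20 * x ^+ 4 & x ^+ 6 <= 27 / 20 * x ^+ 5].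
  by move=> xs; split; rewrite ?(pow_le _ _ xs) //; apply: (pow_le 1%N).
have lo : 27 / 20 <= x -> [/\ 27 / 20 * x ^+ 5 <= x ^+ 6,
    27 / 20 * x ^+ 6 <= x ^+ 7 & 27 / 20 * x ^+ 7 <= x ^+ 8].
  by move=> xs; split; apply: pow_ge.
(* The powers of [x] become independent variables tied only by linear links between neighbours, so
   every claim is a linear problem. The last one uses sharper links on either side of [27/20]. *)
move: {pow_ge0 pow_le pow_ge} (x ^+ 2) (x ^+ 3) (x ^+ 4) (x ^+ 5) (x ^+ 6) (x ^+ 7) (x ^+ 8)
  l1 hi lo => x2 x3 x4 x5 x6 x7 x8 l1 hi lo g2 g3 g4 g5 g6 g7 g8 l2 l3 l4 l5.
split; try by clear hi lo; lra.
have [/hi[]|/ltW/lo[]] := leP x (27 / 20); clear hi lo; lra.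
Qed.

(* What remains of the coefficient of [v^2] in [storage_step] after completing the
   square in [z = v_(k-2)], then in [w = v_(k-1)]. *)
Lemma storage_discr x y : 0 < x <= 149 / 100 -> 0 <= y <= 149 / 100 ->
  0 <= d0f x y - 5 / 4 * x * d2f x y ^+ 2 - 17 / 20
       - (d1f x y + 3 / 2 * d2f x y + 3 / 5) ^+ 2 / (4 * ((2 - x) / (5 * x))).
Proof.
move=> hx /andP[y0 y1]; have /andP[x0 x1] := hx.
have xy0 : 0 <= x * y by rewrite mulr_ge0 // ltW.
pose p0 := 24 + 160 * x + 128 * x ^+ 2 - 108 * x ^+ 3.
pose p1 := 96 + 848 * x + 1192 * x ^+ 2 - 136 * x ^+ 3 - 376 * x ^+ 4.
pose p2 := 144 + 1584 * x + 2932 * x ^+ 2 + 580 * x ^+ 3 - 1140 * x ^+ 4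
  - 328 * x ^+ 5.
pose p3 := 96 + 1264 * x + 2800 * x ^+ 2 + 1176 * x ^+ 3 - 932 * x ^+ 4
  - 336 * x ^+ 5 + 140 * x ^+ 6.
pose p4 := 24 + 368 * x + 932 * x ^+ 2 + 343 * x ^+ 3 - 968 * x ^+ 4
  - 958 * x ^+ 5 - 160 * x ^+ 6 + 175 * x ^+ 7 + 100 * x ^+ 8.
have -> : d0f x y - 5 / 4 * x * d2f x y ^+ 2 - 17 / 20
       - (d1f x y + 3 / 2 * d2f x y + 3 / 5) ^+ 2 / (4 * ((2 - x) / (5 * x)))
  = (p0 + p1 * y + (p2 + p3 * y + p4 * y ^+ 2) * y ^+ 2)
    / (80 * (2 - x) * ((1 + x) * (1 + y + x * y) * (1 + y)) ^+ 2).
  rewrite /d0f /d1f /d2f /p0 /p1 /p2 /p3 /p4; field.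
  by clear p0 p1 p2 p3 p4; repeat (apply/andP; split); lra.
have := storage_coef_ge0 x hx; rewrite /= -/p0 -/p1 -/p2 -/p3 -/p4.
clearbody p0 p1 p2 p3 p4 => -[p00 p10 p20 p30 p40].
apply: divr_ge0; last by rewrite mulr_ge0 ?sqr_ge0 //; lra.
apply: addr_ge0; first by rewrite addr_ge0 ?mulr_ge0.
rewrite mulr_ge0 ?sqr_ge0 //.
by apply: (quad_ge0 (3 / 2)) => //; rewrite ?y0 /=; lra.
Qed.

(* The constant-coefficient form [1/5 (w - 3/2 v)^2 + 2/5 v^2] is a storage
   function for the BDF3 multipliers, uniformly in the step ratios. *)
Definition storage (vv vw ww : R) : R :=
  1 / 5 * (ww - 3 * vw + 9 / 4 * vv) + 2 / 5 * vv.

(** The difference of the two sides is [1/(5x) (z - 3/2 w + 5/2 x d2 v)^2 + c (w + b/(2c) v)^2] plus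
    the remainder of [storage_discr] times [v^2]. The Gram entries are free numbers, so any
    semidefinite form can be inserted. Dividing by [x], the step ratio, turns the weight [tau_k]
    into [tau_(k-1)]. *)
Lemma storage_step x y vv vw vz ww wz zz :
  0 < x <= 149 / 100 -> 0 <= y <= 149 / 100 ->
  (forall a b c, 0 <= a ^+ 2 * vv + b ^+ 2 * ww + c ^+ 2 * zz
     + 2 * (a * b * vw + a * c * vz + b * c * wz)) ->
  storage vv vw ww - storage ww wz zz / x
    <= d0f x y * vv + d1f x y * vw + d2f x y * vz.
Proof.
move=> hx hy gram; have discr := storage_discr _ _ hx hy.
move: (d0f x y) (d1f x y) (d2f x y) discr => d0 d1 d2 discr.
have [x0 x1] := andP hx.
set c := (2 - x) / (5 * x) in discr.
set b := d1 + 3 / 2 * d2 + 3 / 5 in discr.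
have c0 : 0 < c by apply: divr_gt0; lra.
have vv0 : 0 <= vv by have := gram 1 0 0; lra.
have x5 : 0 <= (5 * x)^-1 by rewrite invr_ge0; lra.
have h1 := mulr_ge0 x5 (gram (5 / 2 * x * d2) (- (3 / 2)) 1).
have h2 := mulr_ge0 (ltW c0) (gram (b / (2 * c)) 1 0).
have h3 := mulr_ge0 discr vv0.
rewrite -subr_ge0; apply: le_trans (addr_ge0 h1 (addr_ge0 h2 h3)) _.
rewrite le_eqVlt; apply/orP; left; apply/eqP.
rewrite /storage /c /b; field.
by repeat (apply/andP; split); lra.
Qed.
End Coefficients.

(** * DOC kernels *)

Section Doc.
Context {R : realType}.
Implicit Types (r x : nat -> R) (n i j k : nat).

Lemma size_thetas r n m : size (thetas r n m) = m.+1.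
Proof. by elim: m => //= m IH; rewrite size_rcons IH. Qed.

Lemma nth_thetas r n m i : (i <= m)%N -> nth 0 (thetas r n m) i = theta r n i.
Proof.
elim: m => [|m IH]; first by rewrite leqn0 => /eqP ->.
rewrite leq_eqVlt => /predU1P[-> //|im].
by rewrite /= nth_rcons size_thetas im IH.
Qed.

(** Discrete orthogonality: the recursion defining the kernels is this identity solved for the last
    kernel. *)
Lemma theta_conv0 r n m : dcoef r (n - m) 0 != 0 ->
  \sum_(i < m.+1) theta r n i * dcoef r (n - i) (m - i) = (m == 0%N)%:R.
Proof.
case: m => [|m] d0.
  by move: d0; rewrite big_ord1 subn0 => d0; rewrite /theta /= div1r mulVf.
rewrite big_ord_recr /= {2}/theta /= nth_rcons size_thetas ltnn eqxx subnn.
rewrite div1r mulNr [_^-1 * _]mulrC mulNr mulfVK //.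
rewrite -[X in X - _]/(\sum_(i < m.+1) _).
apply/eqP; rewrite subr_eq0; apply/eqP/eq_bigr => i _.
by rewrite nth_thetas // -ltnS.
Qed.

(** Matrix form of the kernels, [theta^(n)_(n-k)], extended by zero above the diagonal so that
    three-term relations need no boundary cases. *)
Definition doc r n k : R := if (k <= n)%N then theta r n (n - k) else 0.

Lemma doc_conv r n k : (k <= n)%N -> dcoef r k 0 != 0 ->
  doc r n k * dcoef r k 0 + doc r n k.+1 * dcoef r k.+1 1
    + doc r n k.+2 * dcoef r k.+2 2 = (k == n)%:R.
Proof.
move=> kn d0; have := theta_conv0 r n (n - k); rewrite subKn // => /(_ d0).
have -> : ((n - k == 0) = (k == n))%N by lia.
move=> <-; rewrite /doc kn; move em : (n - k)%N => m.
have -> : n = (k + m)%N by lia.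
case: m em => [|[|m]] em.
- rewrite big_ord1 /= addn0 subn0 !ltnNge leqnSn /= leqnn /= !mul0r !addr0.
  by [].
- rewrite !big_ord_recr big_ord0 /= add0r addn1 ltnS leqnn !ltnn mul0r addr0.
  by rewrite subnn addrC subn1.
- rewrite 3!big_ord_recr /= big1 ?add0r; last first.
    move=> i _; have -> : (m.+2 - i)%N = (m - i.+1).+3 by case: i => /=; lia.
    by rewrite mulr0.
  rewrite !ifT; [|lia..].
  have -> : (k + m.+2 - k.+1)%N = m.+1 by lia.
  have -> : (k + m.+2 - k.+2)%N = m by lia.
  have -> : (k + m.+2 - m)%N = k.+2 by lia.
  have -> : (k + m.+2 - m.+1)%N = k.+1 by lia.
  have -> : (k + m.+2 - m.+2)%N = k by lia.
  have -> : (m.+2 - m)%N = 2%N by lia.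
  have -> : (m.+2 - m.+1)%N = 1%N by lia.
  by rewrite subnn /=; ring.
Qed.

(** The shifts move from [x] to [p]. The terms at the upper end carry [p n.+1] and [p n.+2], which
    vanish when [p] is a row of [doc]. *)
Lemma bdf3_sum_by_parts (p a b c x : nat -> R) n : (2 <= n)%N ->
  \sum_(3 <= k < n.+1) p k * (a k * x k + b k * x k.-1 + c k * x k.-2)
  = \sum_(3 <= k < n.+1)
      (p k * a k + p k.+1 * b k.+1 + p k.+2 * c k.+2) * x k
    + (p 3%N * b 3%N + p 4%N * c 4%N) * x 2%N + p 3%N * c 3%N * x 1%N
    - (p n.+1 * b n.+1 + p n.+2 * c n.+2) * x n - p n.+1 * c n.+1 * x n.-1.
Proof.
elim: n => // n IH; rewrite leq_eqVlt => /predU1P[[<-]|n2].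
  by rewrite !big_geq //=; ring.
rewrite big_nat_recr //= IH // [in RHS]big_nat_recr //=.
by case: n n2 {IH} => // n _ /=; ring.
Qed.

Lemma doc_bdf3 r x n : (forall k, (3 <= k <= n)%N -> dcoef r k 0 != 0) ->
  (3 <= n)%N ->
  \sum_(3 <= k < n.+1) doc r n k *
     (dcoef r k 0 * x k + dcoef r k 1 * x k.-1 + dcoef r k 2 * x k.-2)
  = x n + (doc r n 3 * dcoef r 3 1 + doc r n 4 * dcoef r 4 2) * x 2%N
    + doc r n 3 * dcoef r 3 2 * x 1%N.
Proof.
move=> d0 n3; rewrite (bdf3_sum_by_parts (doc r n) (dcoef r ^~ 0%N)
  (dcoef r ^~ 1%N) (dcoef r ^~ 2%N)); last lia.
have docS k : (n < k)%N -> doc r n k = 0 by rewrite /doc ltnNge => /negbTE ->.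
rewrite (docS n.+1) // (docS n.+2) // !mul0r addr0 mul0r !subr0.
congr (_ + _ + _); rewrite big_nat_recr /=; last lia.
rewrite big_nat_cond big1 ?add0r => [|k /andP[kn _]].
  by rewrite doc_conv ?eqxx ?mul1r //; apply: d0; lia.
rewrite doc_conv; [|lia|apply: d0; lia].
by rewrite (_ : (k == n) = false) ?mul0r //; lia.
Qed.
End Doc.

(** * Inversion of the BDF3 operator and the columns of the DOC kernels *)

Section Column.
Context {R : realType}.
Implicit Types (r : nat -> R) (n i j k : nat).

(** Carries the pair [(v_k, v_(k-1))], which makes the second-order recursion structural; the values
    below index 3 are zero. *)
Fixpoint bdf3_state (V : lmodType R) r (w : nat -> V) k : V * V :=
  if k isn't k'.+1 then (0, 0) else
  let p := bdf3_state V r w k' in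
  (if (k < 3)%N then 0
   else (dcoef r k 0)^-1 *: (w k - dcoef r k 1 *: p.1 - dcoef r k 2 *: p.2), p.1).

Definition bdf3_inv (V : lmodType R) r (w : nat -> V) k := (bdf3_state V r w k).1.

Lemma bdf3_inv_small (V : lmodType R) r (w : nat -> V) k :
  (k < 3)%N -> bdf3_inv V r w k = 0.
Proof. by case: k => // k k3; rewrite /bdf3_inv /= k3. Qed.

Lemma bdf3_invE (V : lmodType R) r (w : nat -> V) k :
  (3 <= k)%N -> dcoef r k 0 != 0 ->
  dcoef r k 0 *: bdf3_inv V r w k + dcoef r k 1 *: bdf3_inv V r w k.-1
    + dcoef r k 2 *: bdf3_inv V r w k.-2 = w k.
Proof.
case: k => [|[|[|k]]] // _ d0.
rewrite {1}/bdf3_inv [bdf3_state _ _ _ _]/= -/(bdf3_inv V r w k.+2) -/(bdf3_inv V r w k.+1).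
by rewrite scalerA mulfV // scale1r [X in X + _]addrAC !subrK.
Qed.

(** Keeps the solution inside the domain of the Laplacian, the only place where linearity, symmetry
    and sign are available. *)
Lemma bdf3_inv_closed (V : lmodType R) (P : V -> Prop) r (w : nat -> V) k :
  P 0 -> (forall a v1 v2, P v1 -> P v2 -> P (a *: v1 + v2)) ->
  (forall j, (3 <= j)%N -> P (w j)) -> P (bdf3_inv V r w k).
Proof.
move=> P0 Plin Pw; suff [] : P (bdf3_state V r w k).1 /\ P (bdf3_state V r w k).2 by [].
elim: k => //= k [IH1 IH2]; split=> //; case: ltnP => // k3.
have PZ a v : P v -> P (a *: v) by move=> Pv; rewrite -[_ *: _]addr0; apply: Plin.
apply: PZ; rewrite -scaleNr -scaleNr addrC; apply: (Plin) => //.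
by rewrite addrC; apply: (Plin) => //; apply: Pw.
Qed.

(** The orthogonality makes [doc] a left inverse of the BDF3 matrix; this is the right inverse
    property. The recursion is solved with right-hand side [d_0^(i)] at [i] and zero elsewhere, and
    convolution with [doc] identifies the solution as the scaled column. *)
Lemma doc_column r i : (forall k, (3 <= k)%N -> dcoef r k 0 != 0) -> (3 <= i)%N ->
  doc r i i * dcoef r i 0 = 1 /\
  forall j, (i < j)%N ->
    dcoef r j 0 * (doc r j i * dcoef r i 0)
    + dcoef r j 1 * (doc r j.-1 i * dcoef r i 0)
    + dcoef r j 2 * (doc r j.-2 i * dcoef r i 0) = 0.
Proof.
move=> d0 i3; split.
  by rewrite /doc leqnn subnn /theta /= div1r mulVf // d0.
pose w k : R^o := (k == i)%:R * dcoef r i 0.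
pose v := bdf3_inv R^o r w.
have vE j : v j = doc r j i * dcoef r i 0.
  have [j3|j3] := ltnP j 3.
    by rewrite /v bdf3_inv_small // /doc ifN ?mul0r // -ltnNge (leq_trans j3).
  have := doc_bdf3 r v j (fun k hk => d0 k (proj1 (andP hk))) j3.
  have [v1 v2] : v 1%N = 0 /\ v 2%N = 0 by split; apply: bdf3_inv_small.
  rewrite v1 v2 !mulr0 !addr0 => <-.
  transitivity (\sum_(3 <= k < j.+1) doc r j k * w k).
    rewrite big_nat_cond [RHS]big_nat_cond; apply: eq_bigr => k /andP[/andP[k3 _] _].
    by rewrite -(bdf3_invE R^o r w k k3 (d0 _ k3)).
  have [ij|ij] := leqP i j.
    rewrite (bigD1_seq i) ?iota_uniq ?mem_index_iota ?i3 ?ltnS //= /w eqxx mul1r.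
    by rewrite big1 ?addr0 // => k /negbTE ->; rewrite mul0r mulr0.
  rewrite big_nat_cond big1.
    by rewrite /doc leqNgt ij mul0r.
  move=> k /andP[/andP[_ kj] _]; rewrite /w (_ : (k == i) = false) ?mul0r ?mulr0 //.
  by lia.
move=> j ij; have j3 : (3 <= j)%N by lia.
rewrite -!vE; have := bdf3_invE R^o r w j j3 (d0 _ j3).
by rewrite /w (_ : (j == i) = false) ?mul0r //; lia.
Qed.

Lemma sum_recursion_bound (a : nat -> R) n :
  a 0%N = 1 -> a 1%N <= 6 / 7 -> a 2%N <= 2 / 5 * a 0%N ->
  (forall m, a m.+3 <= 2 / 5 * a m.+1 + 6 / 7 * (17 / 50) * a m) ->
  (forall m, 0 <= a m) -> \sum_(m < n) a m <= 61 / 10.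
Proof.
move=> a0 a1 a2 a3 a_ge0.
rewrite a0 in a2.
pose S n := \sum_(m < n) a m.
have S0 : S 0%N = 0 by rewrite /S big_ord0.
have SS p : S p.+1 = S p + a p by rewrite /S big_ord_recr.
(* Summing the recursion; [13/7 = 1 + 6/7] comes from the first two terms. The fixed point of the
   resulting bound is about [6.02], below [61/10]. *)
have S_le m : S m.+3 <= 13 / 7 + 2 / 5 * S m.+1 + 6 / 7 * (17 / 50) * S m.
  elim: m => [|m IH]; first by rewrite !SS S0 a0; lra.
  by rewrite SS (SS m.+1); have := SS m; have := a3 m; lra.
suff : [/\ S n <= 61 / 10, S n.+1 <= 61 / 10 & S n.+2 <= 61 / 10] by case.
elim: n => [|n [h1 h2 h3]]; first by rewrite !SS S0 a0; split; lra.
by split=> //; have := S_le n; lra.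
Qed.
End Column.

(** * Bounds for the column sums of the DOC kernels *)

Section ColumnSums.
Context {R : realType}.
Implicit Types (r : nat -> R) (n i j k : nat).

Definition ratios_le (c : R) r := forall k, (2 <= k)%N -> 0 < r k <= c.

Lemma ratios_leW (c c' : R) r : c <= c' -> ratios_le c r -> ratios_le c' r.
Proof. by move=> cc rc k /rc/andP[-> /le_trans ->]. Qed.

Lemma dcoef_bounds r k : ratios_le (149 / 100) r -> (3 <= k)%N ->
  [/\ 1 <= dcoef r k 0, dcoef r k 1 <= 0, 0 <= dcoef r k 2,
      - dcoef r k 1 <= 6 / 7 * dcoef r k 0
    & dcoef r k 2 <= 17 / 50 * dcoef r k 0] /\
  - (6 / 7 * dcoef r k 1) - dcoef r k 2 <= 2 / 5 * dcoef r k 0.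
Proof.
move=> hr k3.
have /andP[/ltW x0 x1] : 0 < r k <= 149 / 100 by apply: hr; lia.
have /andP[/ltW y0 y1] : 0 < r k.-1 <= 149 / 100 by apply: hr; lia.
split; first split.
- exact: d0f_ge1.
- exact: d1f_le0.
- exact: d2f_ge0.
- by apply: d1f_le_d0f; apply/andP.
- by apply: d2f_le_d0f; apply/andP.
- by apply: d12f_le_d0f; apply/andP.
Qed.

Lemma dcoef_neq0 r k : ratios_le (149 / 100) r -> (3 <= k)%N -> dcoef r k 0 != 0.
Proof. by move=> hr /(dcoef_bounds r k hr)[[d0 _ _ _ _] _]; lra. Qed.

(* One step of the recursion [d0 z_j + d1 z_(j-1) + d2 z_(j-2) = 0] is not
   contractive in the l1 norm; the composition of two steps is. *)
Lemma two_step_bound (d0 d1 d2 c0 c1 c2 z0 z1 z2 z3 : R) :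
  1 <= d0 -> d1 <= 0 -> 0 <= d2 -> - d1 <= 6 / 7 * d0 -> d2 <= 17 / 50 * d0 ->
  - (6 / 7 * d1) - d2 <= 2 / 5 * d0 ->
  1 <= c0 -> c1 <= 0 -> 0 <= c2 -> - c1 <= 6 / 7 * c0 -> c2 <= 17 / 50 * c0 ->
  d0 * z3 + d1 * z2 + d2 * z1 = 0 -> c0 * z2 + c1 * z1 + c2 * z0 = 0 ->
  `|z3| <= 2 / 5 * `|z1| + 6 / 7 * (17 / 50) * `|z0|.
Proof.
move=> d0_ge1 d1_le0 d2_ge0 d01 d02 d012 c0_ge1 c1_le0 c2_ge0 c01 c02 ez3 ez2.
have d0_gt0 : 0 < d0 by lra.
have c0_gt0 : 0 < c0 by lra.
pose p := - d1 / d0; pose q := d2 / d0; pose p' := - c1 / c0; pose q' := c2 / c0.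
have p_ge0 : 0 <= p by apply: divr_ge0; lra.
have q_ge0 : 0 <= q by apply: divr_ge0; lra.
have p'_ge0 : 0 <= p' by apply: divr_ge0; lra.
have q'_ge0 : 0 <= q' by apply: divr_ge0; lra.
have p_le : p <= 6 / 7 by rewrite /p ler_pdivrMr.
have q_le : q <= 17 / 50 by rewrite /q ler_pdivrMr.
have p'_le : p' <= 6 / 7 by rewrite /p' ler_pdivrMr.
have q'_le : q' <= 17 / 50 by rewrite /q' ler_pdivrMr.
have pq_le : 6 / 7 * p - q <= 2 / 5.
  have -> : 6 / 7 * p - q = (- (6 / 7 * d1) - d2) / d0.
    by rewrite /p /q; field; lra.
  by rewrite ler_pdivrMr.
have -> : z3 = (p * p' - q) * z1 - p * q' * z0.
  have -> : z3 = p * z2 - q * z1.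
    apply: (mulfI (lt0r_neq0 d0_gt0)).
    have -> : d0 * (p * z2 - q * z1) = - d1 * z2 - d2 * z1.
      by rewrite /p /q; field; lra.
    by lra.
  have -> : z2 = p' * z1 - q' * z0.
    apply: (mulfI (lt0r_neq0 c0_gt0)).
    have -> : c0 * (p' * z1 - q' * z0) = - c1 * z1 - c2 * z0.
      by rewrite /p' /q'; field; lra.
    by lra.
  by ring.
clearbody p q p' q'; apply: le_trans (ler_normB _ _) _; rewrite !normrM.
(* [p p' - q] is at most [6/7 p - q <= 2/5] and at least [- q >= - 17/50]. *)
apply: lerD; apply: ler_wpM2r => //.
  by rewrite ler_norml; apply/andP; split; nra.
by rewrite (ger0_norm p_ge0) (ger0_norm q'_ge0); apply: ler_pM.
Qed.

Lemma doc_column_sum_le r i n : ratios_le (149 / 100) r -> (3 <= i)%N ->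
  \sum_(i <= j < n.+1) `|doc r j i * dcoef r i 0| <= 61 / 10.
Proof.
move=> hr i3.
have [e_i e_rec] := doc_column r i (fun k => dcoef_neq0 r k hr) i3.
pose e j := doc r j i * dcoef r i 0.
have e_small : e i.-1 = 0.
  by rewrite /e /doc ifN ?mul0r // -ltnNge; lia.
have e_step j : (i < j)%N ->
    `|e j.+1| <= 2 / 5 * `|e j.-1| + 6 / 7 * (17 / 50) * `|e j.-2|.
  move=> ij; have [j3 j4] : (3 <= j)%N /\ (3 <= j.+1)%N by lia.
  have [[a0 a1 a2 a01 a02] a012] := dcoef_bounds r j.+1 hr j4.
  have [[b0 b1 b2 b01 b02] _] := dcoef_bounds r j hr j3.
  exact: (two_step_bound _ _ _ _ _ _ _ _ (e j) _ a0 a1 a2 a01 a02 a012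
    b0 b1 b2 b01 b02 (e_rec j.+1 (leqW ij)) (e_rec j ij)).
rewrite -{1}[i]add0n big_addn big_mkord.
apply: (sum_recursion_bound (fun m => `|e (m + i)%N|)) => [|||m|m] //.
- by rewrite add0n /e e_i normr1.
- have rel : dcoef r i.+1 0 * e i.+1 + dcoef r i.+1 1 * e i
      + dcoef r i.+1 2 * e i.-1 = 0 := e_rec i.+1 (ltnSn i).
  rewrite e_small /e e_i mulr0 addr0 mulr1 -/(e i.+1) in rel.
  have [[a0 a1 _ a01 _] _] := dcoef_bounds r i.+1 hr (leqW i3).
  rewrite /= add1n; move: (e i.+1) rel => z rel.
  rewrite ler_norml; apply/andP; split; nra.
- by have := e_step i.+1 (ltnSn i); rewrite /= e_small normr0 mulr0 addr0.
- have := e_step (m + i).+2; rewrite -!addSn; apply; lia.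
Qed.

(* The column [theta_(j-i)^(j)], [j >= i], depends on [r (i - 1)] only through
   the factor [1 / d_0^(i)], which is close to its maximum when [r (i - 1)] is small. *)
Lemma doc_column_sum_leK (rmax K : R) r i n : 0 < rmax <= 149 / 100 -> 0 <= K ->
  (forall r', ratios_le rmax r' -> forall n i, (3 <= n)%N -> (3 <= i)%N ->
     \sum_(i <= j < n.+1) `|theta r' j (j - i)| <= K) ->
  ratios_le rmax r -> (3 <= i)%N -> (3 <= n)%N ->
  \sum_(i <= j < n.+1) `|doc r j i * dcoef r i 0| <= 8 / 5 * K.
Proof.
move=> /andP[rmax0 rmax1] K0 HK hr i3 n3.
(* The minimum with [rmax] keeps the modified sequence admissible for [HK]. *)
pose delta : R := Num.min (1 / 1000) rmax.
pose r' k := if k == i.-1 then delta else r k.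
have delta0 : 0 < delta by rewrite lt_min rmax0 andbT; lra.
have hr' : ratios_le rmax r'.
  by move=> k k2; rewrite /r'; case: ifP => _; [rewrite delta0 ge_min lexx orbT|exact: hr].
have hr2 := ratios_leW _ _ _ rmax1 hr; have hr2' := ratios_leW _ _ _ rmax1 hr'.
have [e_i e_rec] := doc_column r i (fun k => dcoef_neq0 r k hr2) i3.
have [e'_i e'_rec] := doc_column r' i (fun k => dcoef_neq0 r' k hr2') i3.
have dcoefE j m : (i < j)%N -> dcoef r' j m = dcoef r j m.
  move=> ij; rewrite /dcoef /r' !ifN //; lia.
(* For [j > i] the coefficients involve only [r j] and [r (j - 1)], hence never [r (i - 1)]; both
   scaled columns solve the same recursion from the value 1. *)
have eE j : doc r' j i * dcoef r' i 0 = doc r j i * dcoef r i 0.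
  elim/ltn_ind: j => j IH; have [ji|] := ltnP j i.
    by rewrite /doc !ifN ?mul0r // -ltnNge.
  rewrite leq_eqVlt => /predU1P[<-|ij]; first by rewrite e_i e'_i.
  have j3 : (3 <= j)%N by lia.
  apply: (mulfI (dcoef_neq0 r j hr2 j3)); move: (e'_rec j ij) (e_rec j ij).
  by rewrite !(dcoefE j) // (IH j.-1) ?(IH j.-2); [lra|lia..].
have d0_le : dcoef r' i 0 <= 8 / 5.
  have /andP[x0 x1] := hr2' i (ltnW i3).
  apply: d0f_small; first by rewrite (ltW x0) x1.
  by rewrite /r' eqxx (ltW delta0) ge_min lexx.
have [[d0_ge1 _ _ _ _] _] := dcoef_bounds r' i hr2' i3.
apply: le_trans (_ : \sum_(i <= j < n.+1) 8 / 5 * `|theta r' j (j - i)| <= _).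
  rewrite big_nat_cond [leRHS]big_nat_cond; apply: ler_sum => j /andP[/andP[ij _] _].
  rewrite -eE /doc ij normrM [`|dcoef _ _ _|]ger0_norm; last lra.
  by rewrite mulrC ler_wpM2r.
by rewrite -mulr_sumr ler_wpM2l ?HK //; lra.
Qed.
End ColumnSums.

(** * Energy estimates *)

Section InnerProduct.
Context {R : realType} {V : lmodType R} {ip : V -> V -> R}.

Lemma ipC (Hip : inner_axioms ip) v w : ip v w = ip w v.
Proof. by case: Hip. Qed.

Lemma ipDl (Hip : inner_axioms ip) u v w : ip (u + v) w = ip u w + ip v w.
Proof. by case: Hip => _ lin _ _; have := lin 1 u v w; rewrite scale1r mul1r. Qed.

Lemma ip0l (Hip : inner_axioms ip) w : ip 0 w = 0.
Proof. by apply: (addrI (ip 0 w)); rewrite -(ipDl Hip) !addr0. Qed.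

Lemma ipZl (Hip : inner_axioms ip) a v w : ip (a *: v) w = a * ip v w.
Proof.
by case: (Hip) => _ lin _ _; have := lin a v 0 w; rewrite (ip0l Hip) !addr0.
Qed.

Lemma ipBl (Hip : inner_axioms ip) u v w : ip (u - v) w = ip u w - ip v w.
Proof. by rewrite ipDl // -scaleN1r ipZl // mulN1r. Qed.

Lemma ipnorm_ge0 v : 0 <= ipnorm ip v.
Proof. exact: sqrtr_ge0. Qed.

Lemma ipnorm_sqr (Hip : inner_axioms ip) v : ipnorm ip v ^+ 2 = ip v v.
Proof. by case: Hip => _ _ pos _; rewrite /ipnorm sqr_sqrtr. Qed.

Lemma ip_cauchy_schwarz (Hip : inner_axioms ip) v w :
  `|ip v w| <= ipnorm ip v * ipnorm ip w.
Proof.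
case: (Hip) => sym lin pos sep.
have [w0|w_neq0] := eqVneq (ip w w) 0.
  by rewrite (sep _ w0) sym (ip0l Hip) normr0 mulr_ge0 ?ipnorm_ge0.
have w_gt0 : 0 < ip w w by rewrite lt_neqAle eq_sym w_neq0 pos.
rewrite -ler_sqr ?nnegrE ?mulr_ge0 ?ipnorm_ge0 //.
rewrite exprMn !ipnorm_sqr // real_normK ?num_real //.
have := pos (- (ip v w / ip w w) *: w + v).
rewrite lin (sym w) (sym v (_ + _)) !lin (sym w v).
rewrite -(pmulr_rge0 _ w_gt0).
have -> : ip w w * (- (ip v w / ip w w) * (- (ip v w / ip w w) * ip w w + ip v w)
  + (- (ip v w / ip w w) * ip v w + ip v v)) = ip v v * ip w w - ip v w ^+ 2.
  by field.
by rewrite subr_ge0.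
Qed.

Lemma ipnorm_dist (Hip : inner_axioms ip) v w :
  (ipnorm ip v - ipnorm ip w) ^+ 2 <= ip (v - w) (v - w).
Proof.
rewrite ipBl // !(ipC Hip _ (v - w)) !ipBl // (ipC Hip w v).
have := le_trans (ler_norm _) (ip_cauchy_schwarz Hip v w).
rewrite -(ipnorm_sqr Hip v) -(ipnorm_sqr Hip w); nra.
Qed.
End InnerProduct.

(** * Positive semidefiniteness of the DOC convolution *)

Section Energy.
Context {R : realType}.

(** Writing [u] as the BDF3 operator applied to [v] collapses each inner sum to [B (v j) (u j)]; the
    storage function then gives a telescoping lower bound. *)
Lemma doc_form_ge0 (V : lmodType R) (P : V -> Prop) (B : V -> V -> R)
    (tau r : nat -> R) (u : nat -> V) n :
  P 0 -> (forall a v w, P v -> P w -> P (a *: v + w)) ->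
  (forall a v w z, P v -> P w -> P z -> B (a *: v + w) z = a * B v z + B w z) ->
  (forall v w, P v -> P w -> B v w = B w v) -> (forall v, P v -> 0 <= B v v) ->
  ratios_le (149 / 100) r -> (2 <= n)%N ->
  (forall k, (1 <= k <= n)%N -> 0 < tau k) ->
  (forall k, (2 <= k <= n)%N -> r k = tau k / tau k.-1) ->
  (forall k, (3 <= k <= n)%N -> P (u k)) ->
  0 <= \sum_(3 <= j < n.+1) tau j * \sum_(3 <= k < j.+1) doc r j k * B (u k) (u j).
Proof.
move=> P0 Plin Blin Bsym Bpos hr n2 tau_gt0 rE Pu.
have d0 := fun k => dcoef_neq0 r k hr.
(* Cutting [u] off puts every right-hand side, and so every [v k], in [P]. *)
pose w k := if (3 <= k <= n)%N then u k else 0.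
pose v := bdf3_inv V r w.
have Pw j : P (w j) by rewrite /w; case: ifP => // /Pu.
have Pv k : P (v k) by apply: bdf3_inv_closed.
(* The trailing [+ 0] gives each layer the shape [a *: v + w] expected by [Blin]. *)
have wE k : (3 <= k)%N -> w k = dcoef r k 0 *: v k
    + (dcoef r k 1 *: v k.-1 + (dcoef r k 2 *: v k.-2 + 0)).
  by move=> k3; rewrite addr0 addrA bdf3_invE ?d0.
have B0 z : P z -> B 0 z = 0.
  by move=> Pz; have := Blin 1 _ _ _ P0 P0 Pz; rewrite scale1r addr0; lra.
have Bw k z : (3 <= k)%N -> P z -> B (w k) z = dcoef r k 0 * B (v k) z
    + dcoef r k 1 * B (v k.-1) z + dcoef r k 2 * B (v k.-2) z.
  move=> k3 Pz; have Pv2 := Plin (dcoef r k 2) _ _ (Pv k.-2) P0.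
  have Pv1 := Plin (dcoef r k 1) _ _ (Pv k.-1) Pv2.
  by rewrite wE // !Blin // B0 // addr0 addrA.
have v_small k : (k < 3)%N -> v k = 0 by apply: bdf3_inv_small.
have rowE j : (3 <= j <= n)%N ->
    \sum_(3 <= k < j.+1) doc r j k * B (u k) (u j) = B (v j) (w j).
  move=> /andP[j3 jn]; have uj : u j = w j by rewrite /w j3 jn.
  pose x k := B (v k) (w j).
  have [x1 x2] : x 1%N = 0 /\ x 2%N = 0 by rewrite /x !v_small // B0.
  have := doc_bdf3 r x j (fun k hk => d0 k (proj1 (andP hk))) j3.
  rewrite x1 x2 !mulr0 !addr0 -/(x j) => <-.
  rewrite big_nat_cond [RHS]big_nat_cond; apply: eq_bigr => k /andP[/andP[k3 kj] _].
  have uk : u k = w k by rewrite /w k3 (leq_trans _ jn).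
  by rewrite uk uj Bw.
pose S k := storage (B (v k) (v k)) (B (v k) (v k.-1)) (B (v k.-1) (v k.-1)).
(* Dissipation inequality: the storage starts at zero, since [v] vanishes below 3, and the final
   storage is nonnegative. *)
suff H m : (2 <= m <= n)%N ->
    tau m * S m <= \sum_(3 <= j < m.+1) tau j * B (v j) (w j).
  have Sn : 0 <= tau n * S n.
    apply: mulr_ge0; first by apply/ltW/tau_gt0; lia.
    have Pz := Plin (- (3 / 2)) _ _ (Pv n) (Pv n.-1).
    have := Bpos _ Pz; rewrite Blin // (Bsym (v n)) // (Bsym (v n.-1)) // !Blin //.
    by have := Bpos _ (Pv n); rewrite /S /storage (Bsym (v n.-1) (v n)) //; lra.
  apply: le_trans Sn _; apply: le_trans (H n _) _; first by rewrite n2 leqnn.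
  rewrite le_eqVlt; apply/orP; left; apply/eqP.
  rewrite big_nat_cond [RHS]big_nat_cond; apply: eq_bigr => j /andP[hj _].
  by rewrite rowE.
elim: m => // m IH; rewrite leq_eqVlt => /andP[/predU1P[[<-]|m2] mn].
  by rewrite big_geq // /S !v_small // B0 // /storage; lra.
rewrite big_nat_recr //=; apply: le_trans (lerD (IH _) (lexx _)); last lia.
have m3 : (3 <= m.+1)%N by [].
have [Pm Pm1 Pm2] : [/\ P (v m.+1), P (v m) & P (v m.-1)] by [].
have gram a b c : 0 <= a ^+ 2 * B (v m.+1) (v m.+1) + b ^+ 2 * B (v m) (v m)
    + c ^+ 2 * B (v m.-1) (v m.-1) + 2 * (a * b * B (v m.+1) (v m)
    + a * c * B (v m.+1) (v m.-1) + b * c * B (v m) (v m.-1)).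
  pose z2 := c *: v m.-1 + 0; pose z1 := b *: v m + z2; pose z := a *: v m.+1 + z1.
  have Pz2 : P z2 by apply: Plin.
  have Pz1 : P z1 by apply: Plin.
  have Pz : P z by apply: Plin.
  have BzE y : P y -> B z y = a * B (v m.+1) y + (b * B (v m) y + c * B (v m.-1) y).
    by move=> Py; rewrite /z Blin // /z1 Blin // /z2 Blin // B0 // addr0.
  have := Bpos z Pz; rewrite BzE // !(Bsym _ z) // !BzE //.
  rewrite (Bsym (v m) (v m.+1)) // (Bsym (v m.-1) (v m.+1)) // (Bsym (v m.-1) (v m)) //.
  lra.
have /andP[x0 x1] := hr m.+1 (ltnW m3).
have /andP[y0 y1] := hr m m2.
have hx : 0 < r m.+1 <= 149 / 100 by rewrite x0 x1.
have hy : 0 <= r m <= 149 / 100 by rewrite (ltW y0) y1.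
have step := storage_step _ _ _ _ _ _ _ _ hx hy gram.
have tm : 0 < tau m by apply: tau_gt0; lia.
have tm1 : 0 < tau m.+1 by apply: tau_gt0; lia.
have -> : B (v m.+1) (w m.+1) = d0f (r m.+1) (r m) * B (v m.+1) (v m.+1)
    + d1f (r m.+1) (r m) * B (v m.+1) (v m) + d2f (r m.+1) (r m) * B (v m.+1) (v m.-1).
  by rewrite Bsym // Bw //= (Bsym (v m)) // (Bsym (v m.-1)).
apply: le_trans (lerD (lexx _) (ler_wpM2l (ltW tm1) step)).
rewrite le_eqVlt; apply/orP; left; apply/eqP.
rewrite /S (rE m.+1) /=; last lia.
by field; rewrite !lt0r_neq0.
Qed.
End Energy.

(** * Estimate at a maximum of the norm, and discrete Gronwall inequality *)

Section Stability.
Context {R : realType}.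

(* Keeping the jump [(s - m)^2] lets the load [a], which acts on [s] only, enter
   with the factor 1 instead of 2. *)
Lemma peak_bound (M m s a y : R) : 0 <= M -> 0 <= m -> 0 <= a -> 0 <= y ->
  M ^+ 2 - m ^+ 2 + (s - m) ^+ 2 <= 2 * s * a + M * y -> M <= m + a + y.
Proof.
move=> M0 m0 a0 y0 h; have [Mq|qM] := leP M (m + a); first lra.
(* Maximising over [s] eliminates it and leaves [M^2 <= (m + a)^2 + M y]. *)
have sq : 2 * s * (m + a) - s ^+ 2 <= (m + a) ^+ 2.
  by have := sqr_ge0 (s - (m + a)); lra.
have Mq : (M - (m + a)) * (M + (m + a)) <= M * y by have := sqr_ge0 a; nra.
have M_gt0 : 0 < M by lra.
have : M * (M - (m + a)) <= M * y by nra.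
by rewrite ler_pM2l //; lra.
Qed.

(** The induction bounds the right-hand side of the hypothesis rather than [s]; each step costs a
    factor [1 + b tau_k <= exp (b tau_k)]. *)
Lemma discrete_gronwall (tau t s : nat -> R) (b x : R) n :
  0 <= b -> 0 <= x -> (forall k, (3 <= k <= n)%N -> 0 <= tau k) ->
  (forall k, (3 <= k <= n)%N -> t k = t k.-1 + tau k) ->
  (forall k, (3 <= k <= n)%N -> s k <= x + b * \sum_(3 <= j < k) tau j * s j) ->
  forall k, (3 <= k <= n)%N -> s k <= x * expR (b * (t k.-1 - t 2%N)).
Proof.
move=> b0 x0 tau0 tE hs.
suff H k : (3 <= k)%N -> (k <= n)%N ->
    x + b * \sum_(3 <= j < k) tau j * s j <= x * expR (b * (t k.-1 - t 2%N)).
  by move=> k kn; have [k3 kn'] := andP kn; apply: le_trans (hs k kn) (H k k3 kn').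
elim: k => // k IH; rewrite leq_eqVlt => /predU1P[[<-]|k3] kn.
  by rewrite big_geq // subrr !mulr0 expR0 mulr1 addr0.
have hk : (3 <= k <= n)%N by lia.
rewrite big_nat_recr //= mulrDr addrA.
have Sk := IH k3 (ltnW kn).
have bt : 0 <= b * tau k by rewrite mulr_ge0 ?tau0.
have -> : b * (t k - t 2%N) = b * (t k.-1 - t 2%N) + b * tau k.
  by rewrite (tE k hk); ring.
rewrite expRD [leRHS]mulrA.
apply: le_trans (_ : x * expR (b * (t k.-1 - t 2%N)) * (1 + b * tau k) <= _).
  rewrite mulrDr mulr1; apply: lerD => //.
  rewrite (mulrA b) [leRHS]mulrC; apply: ler_wpM2l => //.
  exact: le_trans (hs k hk) Sk.
by rewrite ler_wpM2l ?expR_ge1Dx // mulr_ge0 ?expR_ge0.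
Qed.

(** Bounding norms by the peak value [s n] makes the quadratic inequality linear. Summed over [j],
    the starting differences meet the sums of columns 3 and 4, scaled by [d_0]. *)
Lemma peak_estimate (tau s r : nat -> R) (taumax tn K kap F p1 p2 : R) n :
  ratios_le (149 / 100) r -> (3 <= n)%N ->
  0 < K -> 0 <= kap -> 0 <= F -> 0 <= p1 -> 0 <= p2 -> 0 <= taumax ->
  (forall k, 0 <= s k) -> (forall k, (2 <= k <= n)%N -> s k <= s n) ->
  (forall k, (3 <= k <= n)%N -> 0 <= tau k <= taumax) ->
  \sum_(3 <= j < n.+1) tau j <= tn ->
  (forall j, (3 <= j <= n)%N -> \sum_(3 <= k < j.+1) `|doc r j k| <= K) ->
  (forall i, (3 <= i)%N ->
     \sum_(i <= j < n.+1) `|doc r j i * dcoef r i 0| <= 8 / 5 * K) ->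
  s n ^+ 2 - s 2%N ^+ 2 + (s 3%N - s 2%N) ^+ 2 <=
    \sum_(3 <= j < n.+1) 2 * tau j * (s j *
      (\sum_(3 <= k < j.+1) `|doc r j k| * (kap * s k + F)
       + (`|doc r j 3 * dcoef r 3 1| + `|doc r j 4 * dcoef r 4 2|) * p2
       + `|doc r j 3 * dcoef r 3 2| * p1)) ->
  s n <= s 2%N + K * taumax * p1 + 4 * K * taumax * p2 + 2 * K * tn * F
         + 2 * K * kap * \sum_(3 <= j < n.+1) tau j * s j.
Proof.
move=> hr n3 K0 kap0 F0 p10 p20 T0 s0 s_max tau_le sum_tau rows cols hE.
pose e i j := `|doc r j i * dcoef r i 0|.
have e_ge0 i j : 0 <= e i j by apply: normr_ge0.
have in23 j : (3 <= j <= n)%N -> (2 <= j <= n)%N by move=> /andP[/ltnW -> ->].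
pose M := s n; have M0 : 0 <= M by apply: s0.
have tau0 j : (3 <= j <= n)%N -> 0 <= tau j by move=> /tau_le/andP[].
have doc_le i j m c : 0 <= c -> (3 <= i)%N -> `|dcoef r i m| <= c * dcoef r i 0 ->
    `|doc r j i * dcoef r i m| <= c * e i j.
  move=> c0 i3 h; have [[d0 _ _ _ _] _] := dcoef_bounds r i hr i3.
  rewrite /e !normrM mulrCA ler_wpM2l // (ger0_norm (_ : 0 <= dcoef r i 0)) //; lra.
have d31 : `|dcoef r 3 1| <= 6 / 7 * dcoef r 3 0.
  by have [[_ h1 _ h2 _] _] := dcoef_bounds r 3 hr isT; rewrite ler0_norm.
have d32 i : (3 <= i)%N -> `|dcoef r i 2| <= 17 / 50 * dcoef r i 0.
  by move=> i3; have [[_ _ h1 _ h2] _] := dcoef_bounds r i hr i3; rewrite ger0_norm.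
have rows_le j : (3 <= j <= n)%N ->
    \sum_(3 <= k < j.+1) `|doc r j k| * (kap * s k + F) <= K * (kap * M + F).
  move=> /andP[j3 jn].
  apply: le_trans (_ : (\sum_(3 <= k < j.+1) `|doc r j k|) * (kap * M + F) <= _).
    rewrite mulr_suml big_nat_cond [leRHS]big_nat_cond.
    apply: ler_sum => k /andP[/andP[k3 kj] _].
    have kn : (2 <= k <= n)%N by rewrite (ltnW k3) (leq_trans _ jn).
    by rewrite ler_wpM2l // lerD2r ler_wpM2l // s_max.
  by rewrite ler_wpM2r ?rows ?j3 // addr_ge0 ?mulr_ge0.
have e33 : e 3%N 3%N = 1.
  have [h _] := doc_column r 3 (fun k => dcoef_neq0 r k hr) isT.
  by rewrite /e h normr1.
pose W := \sum_(3 <= j < n.+1) tau j * s j.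
pose E3 := \sum_(3 <= j < n.+1) e 3%N j; pose E4 := \sum_(4 <= j < n.+1) e 4%N j.
have E3_le : E3 <= 61 / 10 by apply: doc_column_sum_le.
have E3_leK : E3 <= 8 / 5 * K by apply: cols.
have E4_leK : E4 <= 8 / 5 * K by apply: cols.
have E3_split : E3 = 1 + \sum_(4 <= j < n.+1) e 3%N j.
  by rewrite /E3 big_ltn ?e33.
have E4_split : \sum_(3 <= j < n.+1) e 4%N j = E4.
  by rewrite big_ltn ?[e 4%N 3%N]/e /doc /= ?mul0r ?normr0 ?add0r.
(* The [p1] term at [j = 3], where the scaled column equals 1, keeps its factor [s 3] and serves as
   the load [a] of [peak_bound]; the rest gets the factor [M]. *)
have main : s n ^+ 2 - s 2%N ^+ 2 + (s 3%N - s 2%N) ^+ 2 <=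
    2 * s 3%N * (17 / 50 * taumax * p1)
    + M * (2 * K * kap * W + 2 * K * F * tn
           + 2 * taumax * (6 / 7 * E3 + 17 / 50 * E4) * p2
           + 2 * taumax * (17 / 50) * p1 * (E3 - 1)).
  apply: le_trans hE _.
  apply: le_trans (_ : \sum_(3 <= j < n.+1) (
      M * (2 * K * kap) * (tau j * s j) + M * (2 * K * F) * tau j
      + M * (2 * taumax * p2) * (6 / 7 * e 3%N j + 17 / 50 * e 4%N j)
      + s j * (2 * taumax * (17 / 50) * p1 * e 3%N j)) <= _).
    rewrite big_nat_cond [leRHS]big_nat_cond.
    apply: ler_sum => j /andP[hj _].
    have sj : s j <= M by apply/s_max/in23.
    have /andP[tj0 tjT] := tau_le j hj.
    have h1 := rows_le j hj.
    have h2 : (`|doc r j 3 * dcoef r 3 1| + `|doc r j 4 * dcoef r 4 2|)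
        <= 6 / 7 * e 3%N j + 17 / 50 * e 4%N j.
      by apply: lerD; apply: doc_le => //; [lra|lra|exact: d32].
    have h3 : `|doc r j 3 * dcoef r 3 2| <= 17 / 50 * e 3%N j.
      by apply: doc_le => //; [lra|exact: d32].
    have g2 : 0 <= 6 / 7 * e 3%N j + 17 / 50 * e 4%N j.
      by have := e_ge0 3%N j; have := e_ge0 4%N j; lra.
    have g3 : 0 <= 17 / 50 * e 3%N j by have := e_ge0 3%N j; lra.
    have ts0 : 0 <= tau j * s j by rewrite mulr_ge0.
    have tsM : tau j * s j <= tau j * M by rewrite ler_wpM2l.
    have tsTs : tau j * s j <= taumax * s j by rewrite ler_wpM2r.
    have tsTM : tau j * s j <= taumax * M by rewrite (le_trans tsTs) // ler_wpM2l.
    have k1 := ler_wpM2l ts0 h1.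
    have k2 := ler_wpM2l ts0 (ler_wpM2r p20 h2).
    have k3 := ler_wpM2l ts0 (ler_wpM2r p10 h3).
    have k4 := ler_wpM2r (mulr_ge0 (ltW K0) F0) tsM.
    have k5 := ler_wpM2r (mulr_ge0 g2 p20) tsTM.
    have k6 := ler_wpM2r (mulr_ge0 g3 p10) tsTs.
    lra.
  rewrite !big_split /= -!mulr_sumr -/W big_split /= -!mulr_sumr E4_split -/E3.
  have tail : \sum_(3 <= j < n.+1) s j * (2 * taumax * (17 / 50) * p1 * e 3%N j)
      <= 2 * s 3%N * (17 / 50 * taumax * p1)
         + M * (2 * taumax * (17 / 50) * p1 * (E3 - 1)).
    rewrite big_ltn //.
    rewrite e33 E3_split [1 + _]addrC addrK mulr_sumr mulr_sumr.
    apply: lerD; first lra.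
    rewrite big_nat_cond [leRHS]big_nat_cond.
    apply: ler_sum => j /andP[hj _]; apply: ler_wpM2r.
      by do 2![apply: mulr_ge0 => //]; lra.
    by apply/s_max/in23; have /andP[/ltnW -> jn] := hj.
  have sumF := ler_wpM2l (mulr_ge0 M0 (mulr_ge0 (ltW K0) F0)) sum_tau.
  lra.
have W0 : 0 <= W.
  rewrite /W big_nat_cond; apply: sumr_ge0 => j /andP[hj _].
  by rewrite mulr_ge0 // tau0.
have E4_ge0 : 0 <= E4 by apply: sumr_ge0.
have E3_ge1 : 0 <= E3 - 1.
  by rewrite E3_split [1 + _]addrC addrK; apply: sumr_ge0.
have tn0 : 0 <= tn.
  apply: le_trans sum_tau; rewrite big_nat_cond; apply: sumr_ge0 => j /andP[hj _].
  exact: tau0.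
have Tp1 : 0 <= taumax * p1 by rewrite mulr_ge0.
have Tp2 : 0 <= taumax * p2 by rewrite mulr_ge0.
have Kk : 0 <= K * kap * W by rewrite !mulr_ge0 // ltW.
have KF : 0 <= K * F * tn by rewrite !mulr_ge0 // ltW.
have c2 : 0 <= 6 / 7 * E3 + 17 / 50 * E4 by lra.
(* Both column sums are at most [8/5 K], and [8/5 * (6/7 + 17/50) < 2]. Next, [E3 <= 61/10] gives
   [1 >= 10/61 E3], and [17/50 * (2 - 10/61) * 8/5 < 1]. *)
have c2K : 6 / 7 * E3 + 17 / 50 * E4 <= 2 * K by lra.
have c1K : 17 / 50 * (2 * E3 - 1) <= K by lra.
have l1 := ler_wpM2l Tp1 c1K; have l2 := ler_wpM2l Tp2 c2K.
have n1 := mulr_ge0 Tp1 E3_ge1; have n2 := mulr_ge0 Tp2 c2.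
rewrite -/W; clear E3_split E4_split E3_le E3_leK E4_leK e33 d31.
by apply: le_trans (peak_bound _ _ _ _ _ M0 (s0 2%N) _ _ main) _; lra.
Qed.
End Stability.

(** * Stability of the BDF3 solution *)

Lemma exists_argmax (R : realType) (s : nat -> R) a n : (a <= n)%N ->
  exists2 m, (a <= m <= n)%N & forall k, (a <= k <= n)%N -> s k <= s m.
Proof.
have triv : exists2 m, (a <= m <= a)%N & forall k, (a <= k <= a)%N -> s k <= s m.
  by exists a => [|k]; rewrite ?leqnn // -eqn_leq => /eqP <-.
elim: n => [|n IH]; first by rewrite leqn0 => /eqP a0; move: triv; rewrite a0.
rewrite leq_eqVlt => /predU1P[<- //|/IH[m hm m_max]].
have [sm|sm] := leP (s n.+1) (s m).
  exists m => [|k]; first lia.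
  move=> /andP[ak]; rewrite leq_eqVlt => /predU1P[->//|kn].
  by apply: m_max; rewrite ak.
exists n.+1 => [|k]; first lia.
move=> /andP[ak]; rewrite leq_eqVlt => /predU1P[->//|kn].
by apply: le_trans (m_max k _) (ltW sm); rewrite ak.
Qed.

Lemma term_le_bigmax (R : realType) (F : nat -> R) a n k : (a <= k < n)%N ->
  F k <= \big[Num.max/0]_(a <= j < n) F j.
Proof.
by move=> hk; apply: (le_bigmax_seq 0 k xpredT F) => //; rewrite mem_index_iota.
Qed.

(** Each summand is a difference of squared norms plus a squared increment; only the increment at
    [j = 3] is kept, reduced to norms by the reverse triangle inequality. *)
Lemma energy_telescope (R : realType) (V : lmodType R) (ip : V -> V -> R)
    (t : nat -> R) (u : nat -> V) n :
  inner_axioms ip -> (3 <= n)%N -> (forall k, (3 <= k <= n)%N -> tau t k != 0) ->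
  ipnorm ip (u n) ^+ 2 - ipnorm ip (u 2%N) ^+ 2
    + (ipnorm ip (u 3%N) - ipnorm ip (u 2%N)) ^+ 2
  <= \sum_(3 <= j < n.+1) 2 * tau t j * ip (dtau t u j) (u j).
Proof.
move=> Hip n3 tau0.
have step j : (3 <= j <= n)%N -> 2 * tau t j * ip (dtau t u j) (u j) =
    ipnorm ip (u j) ^+ 2 - ipnorm ip (u j.-1) ^+ 2 + ip (u j - u j.-1) (u j - u j.-1).
  move=> /tau0 tj; rewrite /dtau ipZl // mulrA mulfK // !(ipnorm_sqr Hip).
  rewrite !(ipBl Hip) !(ipC Hip _ (u j - _)) !(ipBl Hip) (ipC Hip (u j.-1) (u j)).
  by ring.
elim: n n3 tau0 step => // n IH; rewrite leq_eqVlt => /predU1P[[<-]|n3] tau0 step.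
  rewrite big_nat1 step //=.
  by have := ipnorm_dist Hip (u 3%N) (u 2%N); lra.
have hn : (3 <= n.+1 <= n.+1)%N by rewrite leqnn andbT ltnW.
rewrite big_nat_recr ?(ltnW n3) //= -/(tau t n.+1) -/(dtau t u n.+1) (step _ hn) /=.
have : 0 <= ip (u n.+1 - u n) (u n.+1 - u n) by case: Hip.
have le_n k : (3 <= k <= n)%N -> (3 <= k <= n.+1)%N by move=> /andP[-> /leqW].
have := IH n3 (fun k hk => tau0 k (le_n k hk)) (fun k hk => step k (le_n k hk)).
lra.
Qed.

Theorem theorem4p4
  (R : realType) (Re : R) (HRe : is_Re Re)
  (* K_3: mesh-independent bound on DOC kernels for all stepratio sequences in (0, R_e] *)
  (K3 : R) (HK3pos : 0 < K3)
  (HK3 : forall r : nat -> R, (forall k, (2 <= k)%N -> 0 < r k <= Re) ->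
     forall n i, (3 <= n)%N -> (3 <= i)%N ->
       \sum_(3 <= j < n.+1) `|theta r n (n - j)| <= K3 /\
       \sum_(i <= j < n.+1) `|theta r j (j - i)| <= K3)
  (* abstract L^2(Omega): real inner product space *)
  (V : lmodType R) (ip : V -> V -> R) (Hip : inner_axioms ip)
  (* Dirichlet Laplacian on its domain Dom: linear, symmetric, nonpositive *)
  (Dom : V -> Prop) (Lap : V -> V)
  (HDom0 : Dom 0) (HDomlin : forall a v w, Dom v -> Dom w -> Dom (a *: v + w))
  (HLaplin : forall a v w, Dom v -> Dom w -> Lap (a *: v + w) = a *: Lap v + Lap w)
  (HLapsym : forall v w, Dom v -> Dom w -> ip (Lap v) w = ip v (Lap w))
  (HLapneg : forall v, Dom v -> ip (Lap v) v <= 0)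
  (* multiplication by kappa, with |kappa| <= kappa* *)
  (Kop : V -> V) (kstar : R) (Hkstar : 0 <= kstar)
  (HKlin : forall a v w, Kop (a *: v + w) = a *: Kop v + Kop w)
  (HKsym : forall v w, ip (Kop v) w = ip v (Kop w))
  (HKbd : forall v, ipnorm ip (Kop v) <= kstar * ipnorm ip v)
  (eps : R) (Heps : 0 < eps)
  (* temporal mesh 0 = t_0 < t_1 < ... < t_N *)
  (N : nat) (t : nat -> R) (Ht0 : t 0%N = 0)
  (Htinc : forall k, (1 <= k <= N)%N -> t k.-1 < t k)
  (Hratio : forall k, (2 <= k <= N)%N -> 0 < stepratio t k < Re)
  (Htau : 4 * K3 * kstar * taumax t N <= 1)
  (* BDF3 solution *)
  (u f : nat -> V)
  (HuDom : forall k, (3 <= k <= N)%N -> Dom (u k))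
  (Hscheme : forall k, (3 <= k <= N)%N ->
     D3 t u k = eps *: Lap (u k) + Kop (u k) + f k) :
  forall n, (3 <= n <= N)%N ->
    ipnorm ip (u n) <=
      2 * expR (4 * K3 * kstar * t n.-1) *
      (ipnorm ip (u 2%N) + K3 * taumax t N * ipnorm ip (dtau t u 1%N)
       + 4 * K3 * taumax t N * ipnorm ip (dtau t u 2%N)
       + 2 * K3 * t n * \big[Num.max/0]_(3 <= k < n.+1) ipnorm ip (f k)).
Proof.
move=> n hn; have [n3 nN] := andP hn.
have Re0 : 0 < Re by case: HRe.
have Re1 : Re <= 149 / 100 by apply/ltW/Re_lt.
(* [HK3] concerns ratio sequences on all indices, so the mesh ratios are continued by [Re] beyond
   [N]. *)
pose r k := if (k <= N)%N then stepratio t k else Re.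
have hrRe : ratios_le Re r.
  move=> k k2; rewrite /r; case: ifP => kN; last by rewrite Re0 lexx.
  by have /andP[-> /ltW ->] : 0 < stepratio t k < Re by apply: Hratio; rewrite k2.
have hr : ratios_le (149 / 100) r by apply: ratios_leW hrRe.
have dcoefE k m : (3 <= k <= N)%N -> dcoef (stepratio t) k m = dcoef r k m.
  move=> /andP[k3 kN]; rewrite /dcoef /r kN.
  by rewrite (_ : (k.-1 <= N)%N) // (leq_trans (leq_pred k)).
have tau_gt0 k : (1 <= k <= N)%N -> 0 < tau t k by move=> /Htinc; rewrite subr_gt0.
pose T := taumax t N.
have tau_le k : (1 <= k <= N)%N -> tau t k <= T by move=> hk; apply: term_le_bigmax.
have T0 : 0 <= T.
  have N1 : (1 <= 1 <= N)%N by rewrite (leq_trans _ (leq_trans n3 nN)).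
  exact: le_trans (ltW (tau_gt0 _ N1)) (tau_le _ N1).
have t_mono j k : (j <= k)%N -> (k <= N)%N -> t j <= t k.
  elim: k => [|k IH]; first by rewrite leqn0 => /eqP ->.
  rewrite leq_eqVlt => /predU1P[->//|jk] kN.
  by apply: le_trans (IH jk (ltnW kN)) (ltW (Htinc k.+1 kN)).
have sum_tau k : (3 <= k <= N)%N -> \sum_(3 <= j < k.+1) tau t j <= t k.
  move=> /andP[k3 kN]; rewrite /tau.
  have -> : \sum_(3 <= j < k.+1) (t j - t j.-1) = t k - t 2%N.
    by rewrite big_add1 -(telescope_sumr t) // ltnW.
  by have := t_mono 0%N 2%N isT (leq_trans (ltnW n3) nN); rewrite Ht0; lra.
pose s k := ipnorm ip (u k); have s0 k : 0 <= s k by apply: ipnorm_ge0.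
pose p1 := ipnorm ip (dtau t u 1%N); pose p2 := ipnorm ip (dtau t u 2%N).
have p10 : 0 <= p1 by apply: ipnorm_ge0.
have p20 : 0 <= p2 by apply: ipnorm_ge0.
pose F := \big[Num.max/0]_(3 <= k < n.+1) ipnorm ip (f k).
have F_ge k : (3 <= k <= n)%N -> ipnorm ip (f k) <= F.
  by move=> hk; apply: (term_le_bigmax _ (fun k => ipnorm ip (f k))).
have F0 : 0 <= F by apply: le_trans (F_ge 3%N n3); apply: ipnorm_ge0.
have energy m : (3 <= m <= n)%N ->
    s m ^+ 2 - s 2%N ^+ 2 + (s 3%N - s 2%N) ^+ 2 <=
    \sum_(3 <= j < m.+1) 2 * tau t j * (s j *
      (\sum_(3 <= k < j.+1) `|doc r j k| * (kstar * s k + F)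
       + (`|doc r j 3 * dcoef r 3 1| + `|doc r j 4 * dcoef r 4 2|) * p2
       + `|doc r j 3 * dcoef r 3 2| * p1)).
  move=> /andP[m3 mn]; have mN := leq_trans mn nN.
  have le3 j k : (j < m.+1)%N -> (3 <= k)%N -> (k < j.+1)%N -> (3 <= k <= N)%N.
    by move=> jm k3 kj; rewrite k3 (leq_trans _ (leq_trans (jm : (j <= m)%N) mN)).
  have le1 k : (3 <= k <= m)%N -> (1 <= k <= N)%N.
    by move=> /andP[/ltnW/ltnW -> km]; rewrite (leq_trans km).
  apply: le_trans (energy_telescope _ _ _ _ u _ Hip m3 _) _.
    by move=> k hk; apply/lt0r_neq0/tau_gt0/le1.
  pose B v w := - ip (Lap v) w.
  have diffusion : 0 <= \sum_(3 <= j < m.+1) tau t j *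
      \sum_(3 <= k < j.+1) doc r j k * B (u k) (u j).
    apply: (doc_form_ge0 _ Dom) => //.
    - move=> a v w z Dv Dw Dz; rewrite /B HLaplin // (ipDl Hip) (ipZl Hip).
      by rewrite opprD mulrN.
    - by move=> v w Dv Dw; rewrite /B HLapsym // (ipC Hip).
    - by move=> v Dv; rewrite /B oppr_ge0 HLapneg.
    - exact: ltnW.
    - by move=> k /andP[k1 km]; apply: tau_gt0; rewrite k1 (leq_trans km).
    - by move=> k /andP[_ km]; rewrite /r (leq_trans km).
    - by move=> k /andP[k3 km]; apply: HuDom; rewrite k3 (leq_trans km).
  (* Subtracting the nonnegative diffusion sum first allows a comparison for each [j] separately. *)
  apply: le_trans (_ : \sum_(3 <= j < m.+1) (2 * tau t j * (s j *
      (\sum_(3 <= k < j.+1) `|doc r j k| * (kstar * s k + F)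
       + (`|doc r j 3 * dcoef r 3 1| + `|doc r j 4 * dcoef r 4 2|) * p2
       + `|doc r j 3 * dcoef r 3 2| * p1))
      - 2 * eps * (tau t j * \sum_(3 <= k < j.+1) doc r j k * B (u k) (u j))) <= _);
    last first.
    rewrite sumrB -mulr_sumr lerBlDr lerDl mulr_ge0 //.
    by apply: mulr_ge0; lra.
  rewrite big_nat_cond [leRHS]big_nat_cond.
  apply: ler_sum => j /andP[hj _]; have [j3 jm] := andP hj.
  have tj : 0 < tau t j by apply/tau_gt0/le1.
  have factor (A L : R) : 2 * tau t j * A - 2 * eps * (tau t j * L)
    = 2 * tau t j * (A - eps * L) by ring.
  rewrite factor; apply: ler_wpM2l; first by rewrite mulr_ge0 // ltW.
  pose y := u j; pose x k := ip (dtau t u k) y.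
  (* The scheme tested with [u j] and convolved with row [j] yields [x j] plus the two starting
     terms. *)
  have := doc_bdf3 r x j (fun k hk => dcoef_neq0 r k hr (proj1 (andP hk))) j3.
  have -> : \sum_(3 <= k < j.+1) doc r j k * (dcoef r k 0 * x k
        + dcoef r k 1 * x k.-1 + dcoef r k 2 * x k.-2)
      = \sum_(3 <= k < j.+1) doc r j k * (ip (Kop (u k)) y + ip (f k) y)
        - eps * \sum_(3 <= k < j.+1) doc r j k * B (u k) y.
    rewrite mulr_sumr -sumrB big_nat_cond [RHS]big_nat_cond.
    apply: eq_bigr => k /andP[/andP[k3 kj] _]; have hk := le3 j k jm k3 kj.
    have -> : dcoef r k 0 * x k + dcoef r k 1 * x k.-1 + dcoef r k 2 * x k.-2
        = ip (D3 t u k) y.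
      by rewrite /D3 /x !dcoefE // !(ipDl Hip) !(ipZl Hip).
    rewrite Hscheme // !(ipDl Hip) (ipZl Hip) /B; ring.
  have cs v : `|ip v y| <= ipnorm ip v * s j by apply: ip_cauchy_schwarz.
  have reaction : \sum_(3 <= k < j.+1) doc r j k * (ip (Kop (u k)) y + ip (f k) y)
      <= s j * \sum_(3 <= k < j.+1) `|doc r j k| * (kstar * s k + F).
    rewrite mulr_sumr big_nat_cond [leRHS]big_nat_cond.
    apply: ler_sum => k /andP[/andP[k3 kj] _].
    rewrite [leRHS]mulrCA; apply: le_trans (ler_norm _) _; rewrite normrM.
    apply: ler_wpM2l => //.
    apply: le_trans (ler_normD _ _) _; rewrite mulrC mulrDl; apply: lerD.
      by apply: le_trans (cs _) _; rewrite ler_wpM2r.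
    apply: le_trans (cs _) _; rewrite ler_wpM2r // F_ge // k3.
    exact: leq_trans (leq_trans (kj : (k <= j)%N) (jm : (j <= m)%N)) mn.
  have start1 : - (doc r j 3 * dcoef r 3 2 * x 1%N)
      <= s j * (`|doc r j 3 * dcoef r 3 2| * p1).
    apply: le_trans (ler_norm _) _; rewrite normrN normrM [leRHS]mulrCA.
    by apply: ler_wpM2l; rewrite // mulrC; apply: cs.
  have start2 : - ((doc r j 3 * dcoef r 3 1 + doc r j 4 * dcoef r 4 2) * x 2%N)
      <= s j * ((`|doc r j 3 * dcoef r 3 1| + `|doc r j 4 * dcoef r 4 2|) * p2).
    apply: le_trans (ler_norm _) _; rewrite normrN normrM [leRHS]mulrCA.
    by apply: ler_pM => //; [exact: ler_normD|rewrite mulrC; apply: cs].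
  rewrite -/y -/(x j) => eqx.
  move: (\sum_(3 <= k < j.+1) doc r j k * B (u k) y) eqx => D eqx; lra.
have row j : (3 <= j)%N -> \sum_(3 <= k < j.+1) `|doc r j k| <= K3.
  move=> j3; have [+ _] := HK3 r hrRe j 3%N j3 isT; apply: le_trans.
  rewrite le_eqVlt; apply/orP; left; apply/eqP.
  rewrite big_nat_cond [RHS]big_nat_cond; apply: eq_bigr => k /andP[/andP[_ kj] _].
  by rewrite /doc (kj : (k <= j)%N).
pose X := s 2%N + K3 * T * p1 + 4 * K3 * T * p2 + 2 * K3 * t n * F.
have peak m : (3 <= m <= n)%N -> (forall k, (2 <= k <= m)%N -> s k <= s m) ->
    s m <= X + 2 * K3 * kstar * \sum_(3 <= j < m.+1) tau t j * s j.
  move=> hm s_max; have [m3 mn] := andP hm; have mN := leq_trans mn nN.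
  have le1 k : (3 <= k <= m)%N -> (1 <= k <= N)%N.
    by move=> /andP[/ltnW/ltnW -> km]; rewrite (leq_trans km).
  apply: (peak_estimate (tau t) s r T (t n) K3 kstar F p1 p2) => //.
  - by move=> k /le1 hk; rewrite ltW ?tau_gt0 //= tau_le.
  - apply: le_trans (sum_tau m _) (t_mono m n mn nN).
    by rewrite m3.
  - by move=> j /andP[j3 _]; apply: row.
  - move=> i i3; apply: (doc_column_sum_leK Re) => //; first by rewrite Re0.
    + exact: ltW.
    + by move=> r' hr' n' i' n'3 i'3; case: (HK3 r' hr' n' i' n'3 i'3).
  - exact: energy.
have X0 : s 2%N <= X.
  have tn0 : 0 <= t n by rewrite -Ht0 t_mono.
  have := mulr_ge0 (mulr_ge0 (ltW HK3pos) T0) p10.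
  have := mulr_ge0 (mulr_ge0 (ltW HK3pos) T0) p20.
  have := mulr_ge0 (mulr_ge0 (ltW HK3pos) tn0) F0.
  by rewrite /X; lra.
have c0 : 0 <= K3 * kstar by rewrite mulr_ge0 // ltW.
have term_ge0 j : (3 <= j <= n)%N -> 0 <= tau t j * s j.
  move=> /andP[j3 jn]; rewrite mulr_ge0 // ltW // tau_gt0 //.
  by rewrite (ltnW (ltnW j3)) (leq_trans jn).
have sum_ge0 k l : (3 <= k)%N -> (l <= n.+1)%N ->
    0 <= \sum_(k <= j < l) tau t j * s j.
  move=> k3 ln; rewrite big_nat_cond; apply: sumr_ge0 => j /andP[/andP[kj jl] _].
  by apply: term_ge0; rewrite (leq_trans k3 kj) -ltnS (leq_trans jl).
have bound k : (3 <= k <= n)%N ->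
    s k <= 2 * X + 4 * K3 * kstar * \sum_(3 <= j < k) tau t j * s j.
  move=> hk; have [k3 kn] := andP hk.
  have Sk := sum_ge0 3%N k isT (leqW kn).
  have cSk := mulr_ge0 c0 Sk.
  (* If the maximum sits at [m = 2], the starting value dominates. If [m = k], the step condition
     bounds the last summand by [s k / 2], and absorbing it doubles the constants. If [m < k], the
     sum up to [m] is part of the sum below [k]. *)
  have [m /andP[m2 mk] s_max] := exists_argmax R s 2%N k (ltnW k3).
  have smk : s k <= s m by apply: s_max; rewrite leqnn (ltnW k3).
  have s_max' i : (2 <= i <= m)%N -> s i <= s m.
    by move=> /andP[i2 im]; apply: s_max; rewrite i2 (leq_trans im).
  move: m2; rewrite leq_eqVlt => /predU1P[m2|m3].
    by rewrite -m2 in smk; have := s0 2%N; lra.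
  have hm : (3 <= m <= n)%N by rewrite m3 (leq_trans mk).
  have sm := peak m hm s_max'.
  move: mk; rewrite leq_eqVlt => /predU1P[mk|mk].
    rewrite mk big_nat_recr //= in sm.
    have hk1 : (1 <= k <= N)%N by rewrite (ltnW (ltnW k3)) (leq_trans kn).
    have := ler_wpM2r (s0 k) (ler_wpM2l c0 (tau_le k hk1)).
    have := ler_wpM2r (s0 k) Htau; rewrite -/T.
    lra.
  have : \sum_(3 <= j < m.+1) tau t j * s j <= \sum_(3 <= j < k) tau t j * s j.
    rewrite [leRHS](big_cat_nat (n := m.+1)) //=; last exact: ltnW.
    by rewrite lerDl sum_ge0 // ltnW.
  move=> /(ler_wpM2l c0); have := s0 2%N; lra.
have b0 : 0 <= 4 * K3 * kstar by lra.
have X20 : 0 <= 2 * X by have := s0 2%N; lra.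
have tE k : (3 <= k <= n)%N -> t k = t k.-1 + tau t k by rewrite /tau addrC subrK.
have tau_ge0 k : (3 <= k <= n)%N -> 0 <= tau t k.
  move=> /andP[k3 kn]; rewrite ltW // tau_gt0 //.
  by rewrite (ltnW (ltnW k3)) (leq_trans kn).
apply: le_trans (discrete_gronwall _ _ _ _ _ _ b0 X20 tau_ge0 tE bound n _) _.
  by rewrite n3 leqnn.
rewrite -/T -/F -/p1 -/p2 -/(s 2%N) -/X [leRHS]mulrAC.
apply: ler_wpM2l => //; rewrite ler_expR; apply: ler_wpM2l => //.
(* The exponent [t_(n-1) - t_2] is relaxed to [t_(n-1)], as [t_2 >= 0]. *)
by rewrite lerBlDr lerDl -Ht0 t_mono // (leq_trans (ltnW n3)).
Qed.
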